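(* Let $k\ge 4$ and let $H$ be a $k$-uniform linear hypercycle with $m\ge 3$ hyperedges. Then $\lambda(H)=m(k-3)$.
   Context: A hypergraph $H$ is a pair $(V(H),E(H))$ with $V(H)$ a finite set and $E(H)$ a finite family of non-empty subsets of $V(H)$ (hyperedges) whose union is $V(H)$. Standing assumption: all hypergraphs are connected and Sperner (no hyperedge is a subset of another hyperedge). $H$ is $k$-uniform if every hyperedge has exactly $k$ elements, and linear if $|E_i\cap E_j|\le 1$ for distinct hyperedges $E_i,E_j$. $H$ is a hypercycle if its hyperedges can be ordered as a sequence $E_1,\ldots,E_m$ such that, for $i\neq j$, $E_i\cap E_j\ne\emptyset$ if and only if $|i-j|=1 \pmod m$, i.e. $E_i$ and $E_j$ are cyclically consecutive. For a vertex $u$, $N(u)$ is the set of vertices $v\ne u$ such that some hyperedge contains both $u$ and $v$. A set $S\subseteq V(H)$ is locating-dominating if for any two distinct $u,v\in V(H)-S$, $N(u)\cap S\neq N(v)\cap S$, and $N(u)\cap S\ne\emptyset$ for every $u\in V(H)-S$. $\lambda(H)$ is the minimum cardinality of a locating-dominating set of $H$.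
   Formalization: For m = 3 it is additionally assumed that the three hyperedges have no common vertex; three hyperedges through one common vertex also meet the stated definition of a linear hypercycle, but there λ(H) ≥ 3(k−2), so the claim fails. *)

(* Defs.v *)
From mathcomp Require Import all_boot.

Set Implicit Arguments.
Unset Strict Implicit.
Unset Printing Implicit Defensive.

(* The vertex set is the whole finite type T. A set of hyperedges, rather than
   an indexed family, loses nothing here: Sperner families have no repetition. *)
Record hypergraph (T : finType) := Hypergraph {
  hedges : {set {set T}};
  hedges_neq0 : set0 \notin hedges;
  hedges_cover : cover hedges = [set: T]
}.

Section Hypergraphs.

Variables (T : finType) (H : hypergraph T).

(* N(u) *)
Definition nbhd (u : T) : {set T} :=
  [set v | (v != u) && [exists e in hedges H, (u \in e) && (v \in e)]].

Definition connected : Prop :=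
  forall u v : T, connect (fun x y => y \in nbhd x) u v.

Definition sperner : Prop :=
  {in hedges H &, forall e f : {set T}, e \subset f -> e = f}.

Definition uniform (k : nat) : Prop :=
  {in hedges H, forall e : {set T}, #|e| = k}.

Definition linear : Prop :=
  {in hedges H &, forall e f : {set T}, e != f -> #|e :&: f| <= 1}.

(* [ordS] is the cyclic successor, modulo the number of hyperedges. *)
Definition hypercycle : Prop :=
  exists E : 'I_#|hedges H| -> {set T},
    [/\ injective E,
        [set E i | i : 'I_#|hedges H|] = hedges H
      & forall i j, i != j ->
          (E i :&: E j != set0 <-> j = ordS i \/ i = ordS j)].

Definition locating_dominating (S : {set T}) : bool :=
  [forall u in ~: S, forall v in ~: S,
     (u != v) ==> (nbhd u :&: S != nbhd v :&: S)]
  && [forall u in ~: S, nbhd u :&: S != set0].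

(* The minimum cardinality of a locating-dominating set; [setT] is the
   starting candidate, which is legitimate by [locating_dominatingT]. *)
Definition locdom_number : nat :=
  #|[arg min_(S < [set: T] | locating_dominating S) #|S|]|.

Lemma locating_dominatingT : locating_dominating [set: T].
Proof.
by apply/andP; split; apply/forall_inP => u; rewrite setCT inE.
Qed.

Lemma locdom_number_ex :
  exists2 S : {set T}, locating_dominating S & #|S| = locdom_number.
Proof.
rewrite /locdom_number; case: arg_minnP; first exact: locating_dominatingT.
by move=> S SP _; exists S.
Qed.

Lemma locdom_number_le (S : {set T}) : locating_dominating S -> locdom_number <= #|S|.
Proof.
rewrite /locdom_number; case: arg_minnP; first exact: locating_dominatingT.
by move=> S0 _; apply.
Qed.

End Hypergraphs.

(* Main.v *)
Require Import Defs.
From mathcomp Require Import all_boot.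

(** Call a vertex of an edge [e] private when [e] is the only edge through it.
    Two private vertices of the same edge are twins: a set that misses both
    cannot tell them apart. So a locating-dominating set contains all but at
    most one of the private vertices of each edge, and since private vertices
    of distinct edges are distinct, it has at least the sum over the edges [e]
    of [p e - 1] elements, where [p e] is the number of private vertices of [e]
    ([private_lower_bound]).

    When the hypergraph is linear and every edge has at least two private
    vertices, this bound is attained by taking all private vertices but one per
    edge: every edge keeps a private vertex in the set, so the trace of [N(u)]
    on the set reveals exactly which edges pass through [u], and linearity
    leaves only one vertex outside the set with that collection of edges
    ([locdom_number_private]).

    In a linear hypercycle an edge meets just its predecessor and its successor,
    in one vertex each, and these two vertices differ: a vertex common to three
    consecutive edges makes the outer two meet, so they are consecutive as well,
    and the hypergraph is a star with just three edges, which is excluded.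
    Hence a [k]-element edge has [k - 2] private vertices
    ([hypercycle_private]), and the sum above is [m * (k - 3)]. *)

Set Implicit Arguments.
Unset Strict Implicit.
Unset Printing Implicit Defensive.

(** * Cyclic successors *)

Lemma iter_ordS_fix n k (i : 'I_n) : (iter k (@ordS n) i == i) = (n %| k).
Proof.
have valE : val (iter k (@ordS n) i) = (i + k) %% n.
  elim: k => [|k IHk]; first by rewrite addn0 modn_small.
  by rewrite iterS /= IHk -addn1 modnDml addn1 addnS.
rewrite -val_eqE valE -[X in _ == X](modn_small (ltn_ord i)).
by rewrite -[X in _ == X %[mod n]]addn0 eqn_modDl mod0n.
Qed.

Lemma iter_ordS_neq n k (i : 'I_n) : 0 < k < n -> iter k (@ordS n) i != i.
Proof. by move=> /andP[k0 kn]; rewrite iter_ordS_fix gtnNdvd. Qed.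

(** * Private vertices and locating-dominating sets *)

Section PrivateVertices.

Variables (T : finType) (H : hypergraph T).
Implicit Types (e f S : {set T}) (u v : T).

Definition private e : {set T} :=
  [set v in e | [forall f in hedges H, (v \in f) ==> (f == e)]].

Lemma privateP e v :
  reflect (v \in e /\ {in hedges H, forall f, v \in f -> f = e})
          (v \in private e).
Proof.
rewrite inE; apply: (iffP andP) => -[ve vP]; split=> //.
  by move=> f fH vf; apply/eqP; have /forall_inP/(_ f fH)/implyP/(_ vf) := vP.
by apply/forall_inP => f fH; apply/implyP => vf; apply/eqP/vP.
Qed.

Lemma nbhdP u v :
  reflect (v != u /\ exists2 e, e \in hedges H & u \in e /\ v \in e)
          (v \in nbhd H u).
Proof.
rewrite inE; apply: (iffP andP) => -[vu].
  by move=> /exists_inP[e eH /andP[ue ve]]; split=> //; exists e.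
move=> [e eH [ue ve]]; split=> //; apply/exists_inP; exists e => //.
by rewrite ue.
Qed.

Lemma vertex_edge u : exists2 e, e \in hedges H & u \in e.
Proof.
have: u \in cover (hedges H) by rewrite hedges_cover inE.
by move=> /bigcupP[e]; exists e.
Qed.

Lemma nbhd_private e u :
  e \in hedges H -> u \in private e -> nbhd H u = e :\ u.
Proof.
move=> eH /privateP[ue uP]; apply/setP => v; rewrite in_setD1.
apply/nbhdP/andP => -[vu]; first by move=> [f fH [/(uP f fH) <-]].
by move=> ve; split=> //; exists e.
Qed.

Lemma private_edge e v : v \in private e -> e \in hedges H.
Proof.
by move=> /privateP[_ vP]; have [f fH vf] := vertex_edge v; rewrite -(vP f).
Qed.

Lemma private_inj e f v : v \in private e -> v \in private f -> e = f.
Proof.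
move=> ve /privateP[_ vf]; apply: vf (private_edge ve) _.
by have /privateP[] := ve.
Qed.

(** The sets [A e] are disjoint because a vertex is private to at most one
    edge. *)
Lemma card_bigcup_private (A : {set T} -> {set T}) :
    (forall e, A e \subset private e) ->
  #|\bigcup_(e in hedges H) A e| = \sum_(e in hedges H) #|A e|.
Proof.
move=> sA; rewrite [in LHS]big_mkcond [RHS]big_mkcond -sum1_card.
rewrite partition_disjoint_bigcup => [|e f ef].
  by apply: eq_bigr => e _; case: ifP; rewrite ?big_set0 ?sum1_card.
rewrite -setI_eq0; apply: contraNT ef => /set0Pn[v].
rewrite inE; case: ifP; case: ifP; rewrite ?inE ?andbF // => _ _ /andP[ve vf].
by rewrite (private_inj (subsetP (sA e) v ve) (subsetP (sA f) v vf)).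
Qed.

(** The private vertices of an edge are twins, so at most one of them escapes
    a locating-dominating set. *)
Lemma card_private_missed S e :
  locating_dominating H S -> #|private e :\: S| <= 1.
Proof.
move=> /andP[/forall_inP locS _]; apply/card_le1_eqP => u v.
move=> /setDP[ue uS] /setDP[ve vS]; apply/eqP; apply: contraT => uv.
have {locS}:= locS u; rewrite inE => /(_ uS)/forall_inP/(_ v).
rewrite inE eq_sym uv => /(_ vS)/eqP[]; have eH := private_edge ue.
rewrite (nbhd_private eH ue) (nbhd_private eH ve); apply/setP => x; rewrite !inE.
case xS: (x \in S); last by rewrite !andbF.
have -> : x != u by apply: contraNneq uS => <-.
by have -> : x != v by apply: contraNneq vS => <-.
Qed.

Lemma private_lower_bound S :
    locating_dominating H S ->
  \sum_(e in hedges H) (#|private e| - 1) <= #|S|.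
Proof.
move=> ldS.
have sS : \bigcup_(e in hedges H) (private e :&: S) \subset S.
  by apply/bigcupsP => e _; apply: subsetIr.
apply: leq_trans (subset_leq_card sS).
rewrite card_bigcup_private => [|e]; last exact: subsetIl.
apply: leq_sum => e _; rewrite -(cardsID S (private e)) leq_subLR addnC.
by rewrite leq_add2r; exact: card_private_missed.
Qed.

Lemma all_but_one (P : {set T}) :
  exists A : {set T},
    [/\ A \subset P, #|A| = #|P| - 1 & #|P :\: A| <= 1].
Proof.
have [->|[x xP]] := set_0Vmem P.
  by exists set0; rewrite sub0set setD0 cards0.
exists (P :\ x); rewrite subsetDl (cardsD1 x P) xP add1n subn1; split=> //.
rewrite setDDr setDv set0U (leq_trans (subset_leq_card (subsetIr _ _))) //.
by rewrite cards1.
Qed.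

(** A choice of private vertices meeting every edge identifies the edges
    through any vertex [u] outside it: they are the edges whose chosen vertices
    are neighbours of [u]. *)
Lemma private_nbhd (A : {set T} -> {set T}) u e :
    (forall f, A f \subset private f) -> {in hedges H, forall f, A f != set0} ->
    u \notin \bigcup_(f in hedges H) A f -> e \in hedges H ->
  (u \in e) = (nbhd H u :&: A e != set0).
Proof.
move=> sA A0 uA eH; apply/idP/idP => [ue|/set0Pn[v /setIP[uv vA]]].
  have /set0Pn[v vA] := A0 e eH; apply/set0Pn; exists v; rewrite inE vA andbT.
  apply/nbhdP; split; last first.
    by exists e => //; split=> //; case/privateP: (subsetP (sA e) v vA).
  by apply: contraNneq uA => <-; apply/bigcupP; exists e.
case/privateP: (subsetP (sA e) v vA) => _ vP.
by case/nbhdP: uv => _ [f fH [uf vf]]; rewrite -(vP f).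
Qed.

(** All private vertices but one per edge form such a set. Two vertices outside
    it with the same trace lie on the same edges: if there are two such edges,
    linearity makes the vertices equal; if there is one, both vertices are the
    private vertex that was left out of it. *)
Lemma private_upper_bound :
    linear H -> {in hedges H, forall e, 1 < #|private e|} ->
  exists2 S, locating_dominating H S
           & #|S| = \sum_(e in hedges H) (#|private e| - 1).
Proof.
move=> linH priv2.
have [A AP] := fin_all_exists (fun e => all_but_one (private e)).
have sA e : A e \subset private e by case: (AP e).
have A0 : {in hedges H, forall e, A e != set0}.
  by move=> e /priv2; rewrite -card_gt0; case: (AP e) => _ -> _; rewrite subn_gt0.
set S := \bigcup_(e in hedges H) A e.
have sAS e : e \in hedges H -> A e \subset S by exact: bigcup_sup.
exists S; last first.
  by rewrite card_bigcup_private //; apply: eq_bigr => e _; case: (AP e).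
apply/andP; split; apply/forall_inP => u; rewrite inE => uS; last first.
  have [e eH] := vertex_edge u; rewrite (private_nbhd sA A0 uS eH).
  by apply: contraNneq => uS0; rewrite -subset0 -uS0 setIS ?sAS.
apply/forall_inP => v; rewrite inE => vS; apply/implyP; apply: contraNneq => eqN.
have eqE : {in hedges H, forall e : {set T}, (u \in e) = (v \in e)}.
  move=> e eH; rewrite (private_nbhd sA A0 uS eH) (private_nbhd sA A0 vS eH).
  by rewrite -(setIidPr (sAS e eH)) !setIA eqN.
have [e eH ue] := vertex_edge u; have ve : v \in e by rewrite -eqE.
have [uP|] := boolP (u \in private e).
  have vP : v \in private e.
    apply/privateP; split=> // f fH vf; case/privateP: uP => _; apply=> //.
    by rewrite eqE.
  have [_ _ /card_le1_eqP missed1] := AP e.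
  have notA x : x \notin S -> x \notin A e.
    by apply: contraNN; apply/subsetP/sAS.
  by rewrite (missed1 u v) // in_setD notA.
rewrite inE ue => /forall_inPn[f fH]; rewrite negb_imply => /andP[uf fe].
have /card_le1_eqP meet1 := linH f e fH eH fe.
by rewrite (meet1 u v) // inE ?uf // ve andbT -eqE.
Qed.

Lemma locdom_number_private :
    linear H -> {in hedges H, forall e, 1 < #|private e|} ->
  locdom_number H = \sum_(e in hedges H) (#|private e| - 1).
Proof.
move=> linH priv2; apply/eqP; rewrite eqn_leq; apply/andP; split.
  have [S ldS <-] := private_upper_bound linH priv2.
  exact: locdom_number_le.
have [S ldS <-] := locdom_number_ex H.
exact: private_lower_bound.
Qed.

End PrivateVertices.

(** * Edges of a linear hypercycle *)

(** For three edges the hypothesis on the intersection of all edges does the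
    work; with more than three edges the outer two of three consecutive ones
    are not themselves consecutive, hence disjoint. *)
Lemma hypercycle_consecutive_meet (T : finType) (H : hypergraph T)
    (E : 'I_#|hedges H| -> {set T}) (i : 'I_#|hedges H|) :
    2 < #|hedges H| -> [set E j | j : 'I_#|hedges H|] = hedges H ->
    (forall i j, i != j -> E i :&: E j != set0 -> j = ordS i \/ i = ordS j) ->
    (#|hedges H| = 3 -> \bigcap_(e in hedges H) e = set0) ->
  E i :&: E (ordS i) :&: E (ordS (ordS i)) = set0.
Proof.
move=> m3 imE adjE starH; apply: contraTeq isT => /set0Pn[x].
rewrite !inE -andbA => /and3P[x0 x1 x2].
have neq1 (j : 'I_#|hedges H|) : ordS j != j.
  by apply: (@iter_ordS_neq _ 1); exact: ltnW.
have neq2 (j : 'I_#|hedges H|) : ordS (ordS j) != j.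
  exact: (@iter_ordS_neq _ 2).
(* The outer two edges both contain [x], so they are consecutive, and the
   only way for that is to go round the cycle in three steps. *)
have cycle3 : ordS (ordS (ordS i)) = i.
  have i2 : i != ordS (ordS i) by rewrite eq_sym.
  have meet : E i :&: E (ordS (ordS i)) != set0.
    by apply/set0Pn; exists x; rewrite inE x0.
  by case: (adjE _ _ i2 meet) => [/eqP|<-//]; rewrite (negPf (neq1 _)).
have m_eq3 : #|hedges H| = 3.
  apply/eqP; rewrite eqn_leq m3 andbT dvdn_leq // -(@iter_ordS_fix _ 3 i).
  exact/eqP.
suff: x \in \bigcap_(e in hedges H) e by rewrite starH ?inE.
apply/bigcapP => e; rewrite -imE => /imsetP[j _ ->].
have: j \in [set i; ordS i; ordS (ordS i)].
  suff -> : [set i; ordS i; ordS (ordS i)] = [set: 'I__] by rewrite inE.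
  apply/eqP; rewrite eqEcard subsetT cardsT card_ord -setUA cardsU1 cards2.
  rewrite !inE negb_or ![i == _]eq_sym ![ordS i == ordS _]eq_sym !neq1 neq2.
  by rewrite m_eq3.
by rewrite !inE -orbA => /or3P[] /eqP->.
Qed.

(** The vertices that are not private are those shared with the predecessor or
    the successor, one each. *)
Lemma hypercycle_private (T : finType) (H : hypergraph T) (e : {set T}) :
    2 < #|hedges H| -> linear H -> hypercycle H ->
    (#|hedges H| = 3 -> \bigcap_(e in hedges H) e = set0) ->
  e \in hedges H -> #|private H e| = #|e| - 2.
Proof.
move=> m3 linH [E [injE imE adjE]] starH; rewrite -{1}imE => /imsetP[j _ ->] {e}.
have EH i : E i \in hedges H by rewrite -imE imset_f.
(* With [i] the predecessor of [j], the three edges that matter are all written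
   as iterated successors of [i]. *)
rewrite -(ord_predK j); move: (ord_pred j) => i {j}.
have neq1 (j : 'I_#|hedges H|) : ordS j != j.
  by apply: (@iter_ordS_neq _ 1); exact: ltnW.
have meet1 j : #|E j :&: E (ordS j)| = 1.
  apply/eqP; rewrite eqn_leq linH ?EH //=; last first.
    by rewrite (inj_eq injE) eq_sym neq1.
  by rewrite card_gt0; apply/adjE; [rewrite eq_sym neq1|left].
have shared : E (ordS i) :\: private H (E (ordS i)) =
    (E i :&: E (ordS i)) :|: (E (ordS i) :&: E (ordS (ordS i))).
  apply/setP => x; rewrite !inE; apply/andP/idP.
    case=> /[swap] x1; rewrite x1 andbT /= => /forall_inPn[f].
    rewrite -{1}imE => /imsetP[j _ ->]; rewrite negb_imply => /andP[xj].
    rewrite (inj_eq injE) eq_sym => ij.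
    have: E (ordS i) :&: E j != set0 by apply/set0Pn; exists x; rewrite inE x1.
    case/(adjE _ _ ij) => [ej|/(can_inj (@ordSK _)) ej].
      by rewrite -ej xj orbT.
    by rewrite ej xj.
  move=> x01; have x1 : x \in E (ordS i) by case/orP: x01 => /andP[].
  split=> //; rewrite x1 /=; apply/forall_inPn.
  case/orP: x01 => /andP[x0 x2].
    exists (E i); rewrite ?EH // negb_imply x0 (inj_eq injE) eq_sym.
    exact: neq1.
  exists (E (ordS (ordS i))); rewrite ?EH // negb_imply x2 (inj_eq injE).
  exact: neq1.
have disj : (E i :&: E (ordS i)) :&: (E (ordS i) :&: E (ordS (ordS i))) = set0.
  rewrite setIA -(setIA (E i)) setIid.
  by apply: hypercycle_consecutive_meet => // a b ab; case: (adjE a b ab).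
have subP : private H (E (ordS i)) \subset E (ordS i).
  by apply/subsetP => x /privateP[].
have := cardsDS subP; rewrite shared cardsU disj cards0 !meet1 subn0 addn1.
by move=> ->; rewrite subKn // subset_leq_card.
Qed.

(* For m = 3 any two positions are cyclically consecutive, so [hypercycle]
   alone also admits three hyperedges through one common vertex (a hyperstar),
   for which the minimum is 3 * (k - 2); [no_star] excludes exactly that case.
   For m > 3 no vertex can lie in three hyperedges of a hypercycle. *)
Theorem corollary3p3 (T : finType) (H : hypergraph T) (k m : nat)
    (k_ge4 : 4 <= k) (m_ge3 : 3 <= m)
    (conn_H : connected H) (sperner_H : sperner H)
    (unif_H : uniform H k) (lin_H : linear H)
    (cycle_H : hypercycle H) (card_H : #|hedges H| = m)
    (no_star : m = 3 -> \bigcap_(e in hedges H) e = set0) :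
  locdom_number H = m * (k - 3).
Proof.
have m3 : 2 < #|hedges H| by rewrite card_H.
have card_private e : e \in hedges H -> #|private H e| = k - 2.
  move=> eH; rewrite hypercycle_private ?unif_H //.
  by rewrite card_H.
rewrite locdom_number_private //; last first.
  by move=> e /card_private ->; rewrite ltn_subRL.
under eq_bigr => e /card_private -> do rewrite -subnDA.
by rewrite sum_nat_const card_H.
Qed.
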